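(* Let $\ell\ge 2$. If $K$ is a $(q, k, \lambda)$-difference set of $\mathbb{F}_q$, then $$\det(A) = - \lambda (k - \lambda)^{\frac{\ell}{2}-1} \quad \text{and} \quad \det(B) = (-1)^{\frac{\ell}{2}-1} (k - \lambda)^{\frac{\ell}{2}},$$ where $A = [(i,j)]_{0\le i,j\le \ell-1}$ is the cyclotomic matrix and $B$ is the $(\ell-1)\times(\ell-1)$ submatrix obtained from $A$ by deleting the column indexed by $0$ and the row whose index is congruent to $q'$ modulo $\ell$ (the remaining rows and columns being kept in their order).
   Context: Let $q$ be a power of an odd prime, $\ell$ a divisor of $q-1$, $g$ a fixed generator of $\mathbb{F}_q^{*}$, $K$ the subgroup of $\mathbb{F}_q^*$ consisting of all $\ell$-th powers of nonzero elements, $k=|K|=\frac{q-1}{\ell}$, and $q'=\frac{q-1}{2}$. For integers $i,j$ the cyclotomic number is $(i,j) = \left| (1 + g^i K) \cap g^j K \right|$, which depends only on $i,j$ modulo $\ell$. Rows and columns of $A$ are indexed by $0,\dots,\ell-1$. $K$ is a $(q,k,\lambda)$-difference set if $\lambda$ is a positive integer such that every nonzero element of $\mathbb{F}_q$ can be written as $x-y$ with $(x,y)\in K\times K$ in exactly $\lambda$ ways (when $\ell\ge2$ this forces $\ell$ to be even). *)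

(* Defs.v *)
From HB Require Import structures.
From mathcomp Require Import all_boot all_order all_algebra all_fingroup all_solvable all_field.

Set Implicit Arguments.
Unset Strict Implicit.
Unset Printing Implicit Defensive.

Import GRing.Theory.
Local Open Scope ring_scope.

Definition power_subgroup (F : finFieldType) (l : nat) : {set F} :=
  [set x ^+ l | x : F & x != 0].

(* Exponents are integers, so [^] is [exprz]; this is meant for [g != 0]. *)
Definition cyclotomic_number (F : finFieldType) (g : F) (l : nat)
    (i j : int) : nat :=
  let K := power_subgroup F l in
  #|[set (1 + g ^ i * x : F) | x in K] :&: [set (g ^ j * x : F) | x in K]|.

Definition cyclotomic_matrix (F : finFieldType) (g : F) (l : nat) :
    'M[int]_l :=
  \matrix_(i < l, j < l) (cyclotomic_number g l i j)%:Z.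

(* [row'] and [col'] delete a row and a column and keep the others in order;
   the deleted row is the residue modulo [l] of (q - 1) / 2. *)
Definition cyclotomic_submatrix (F : finFieldType) (g : F) (l : nat)
    (l_gt0 : (0 < l)%N) : 'M[int]_(l.-1) :=
  row' (Ordinal (ltn_pmod ((#|F|.-1) %/ 2) l_gt0))
    (col' (Ordinal l_gt0) (cyclotomic_matrix g l)).

Definition difference_set (G : finZmodType) (v k lam : nat) (D : {set G}) :=
  [/\ #|G| = v, #|D| = k, (0 < lam)%N
    & forall d : G, d != 0 ->
        #|[set p : G * G | [&& p.1 \in D, p.2 \in D & d == p.1 - p.2]]| = lam].

(* Main.v *)
Require Import Defs.
From HB Require Import structures.
From mathcomp Require Import all_boot all_order all_algebra all_fingroup all_solvable all_field.
From mathcomp Require Import all_character zify ring.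

Set Implicit Arguments.
Unset Strict Implicit.
Unset Printing Implicit Defensive.

Import GRing.Theory Num.Theory.
Local Open Scope ring_scope.

(* Let h be the residue of (q-1)/2 modulo l and let A' be A with k subtracted
   from the entries of row h. For a nontrivial additive character psi of F, the
   Gauss periods eta(c) = sum_(x in K) psi(x c) satisfy
     eta(c) eta(c g^i) = k [i = h] + sum_j (i,j) eta(c g^j)
   and sum_j eta(c g^j) = -1, so that (eta(g^m g^j))_j is an eigenvector of A'
   with eigenvalue eta(g^m). These l vectors are independent by orthogonality of
   characters. The difference set property gives eta(c) eta(-c) = k - lam,
   whence h = l/2 and det A' = (k - lam)^(l/2). It also makes column 0 of A
   constant equal to lam; together with the row sums of A and A', this relates
   det A, det A' and their common cofactor at (h, 0), which is det B up to sign. *)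

(** * Cosets of [K] and cyclotomic numbers *)

Section CyclotomicClasses.

Variables (F : finFieldType) (g : {unit F}) (l : nat).
Hypothesis g_gen : generator [set: {unit F}] g.
Hypothesis l_gt0 : (0 < l)%N.
Hypothesis l_dvd : (l %| #|F|.-1)%N.

Local Notation K := (power_subgroup F l).
Local Notation gm := (val g : F).
Local Notation h := ((#|F|.-1 %/ 2) %% l)%N.

Lemma gen_neq0 : gm != 0.
Proof. by rewrite -unitfE; exact: (valP g). Qed.

Lemma gen_surj (z : F) : z != 0 -> exists e, z = gm ^+ e.
Proof.
rewrite -unitfE => zU.
have: FinRing.unit F zU \in [set: {unit F}] by rewrite inE.
rewrite (eqP g_gen) => /cycleP[e He]; exists e.
by rewrite -FinRing.val_unitX -He.
Qed.

Lemma gen_inj_mod (a b : nat) :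
  (gm ^+ a == gm ^+ b) = (a == b %[mod #|F|.-1])%N.
Proof.
rewrite -!FinRing.val_unitX (inj_eq val_inj) eq_expg_mod_order.
by rewrite orderE -(eqP g_gen) card_finField_unit.
Qed.

Lemma memK_gen (e : nat) : (gm ^+ e \in K) = (l %| e)%N.
Proof.
apply/imsetP/idP => [[x]|/dvdnP[t ->]].
  rewrite inE => /gen_surj[a ->] /eqP; rewrite -exprM gen_inj_mod => /eqP He.
  rewrite /dvdn -(modn_dvdm e l_dvd) He modn_dvdm //.
  by rewrite modnMl.
by exists (gm ^+ t); rewrite ?exprM // inE expf_neq0 // gen_neq0.
Qed.

Lemma K_neq0 x : x \in K -> x != 0.
Proof. by case/imsetP=> y; rewrite inE => y0 ->; rewrite expf_neq0. Qed.

Lemma K1 : 1 \in K.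
Proof. by apply/imsetP; exists 1; rewrite ?expr1n // inE oner_neq0. Qed.

Lemma KM x y : x \in K -> y \in K -> x * y \in K.
Proof.
case/imsetP=> a; rewrite inE => a0 ->; case/imsetP=> b; rewrite inE => b0 ->.
by apply/imsetP; exists (a * b); rewrite ?exprMn // inE mulf_neq0.
Qed.

Lemma KV x : x \in K -> x^-1 \in K.
Proof.
case/imsetP=> a; rewrite inE => a0 ->.
by apply/imsetP; exists a^-1; rewrite ?exprVn // inE invr_neq0.
Qed.

Lemma KMr x y : y \in K -> (x * y \in K) = (x \in K).
Proof.
move=> yK; apply/idP/idP => [/KM/(_ (KV yK))|xK]; last exact: KM.
by rewrite mulfK ?K_neq0.
Qed.

Lemma coset_gen (e j : nat) :
  (j < l)%N -> (gm ^+ e / gm ^+ j \in K) = (e %% l == j)%N.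
Proof.
(* Multiplying by g^(j l), an element of [K], turns the quotient into the natural power g^(e + j l -
   j). *)
move=> jl; rewrite -(KMr _ (_ : gm ^+ (j * l) \in K)); last first.
  by rewrite memK_gen dvdn_mull.
have le_j : (j <= j * l)%N by rewrite leq_pmulr.
rewrite -mulrA -[in X in _ * X](subnKC le_j) exprD mulKf ?expf_neq0 ?gen_neq0 //.
rewrite -exprD memK_gen -[in RHS](modn_small jl).
rewrite addnBA // -eqn_mod_dvd; last by rewrite (leq_trans le_j) ?leq_addl.
by rewrite addnC modnMDl.
Qed.

Lemma sum_coset_mem (z : F) :
  (\sum_(j < l) (z / gm ^+ j \in K)%R)%N = (z != 0).
Proof.
have [->|/gen_surj[e ->]] := eqVneq z 0.
  by rewrite big1 // => j _; rewrite mul0r; case: (boolP (0 \in K)) => // /K_neq0; rewrite eqxx.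
rewrite (bigD1 (Ordinal (ltn_pmod e l_gt0))) //= coset_gen ?ltn_pmod // eqxx.
rewrite big1 // => j; rewrite coset_gen // eq_sym.
by rewrite -(inj_eq val_inj) /= => /negPf->.
Qed.

(** The cosets g^j K with j < l partition the nonzero elements: each nonzero z is counted for
    exactly one j. *)
Lemma big_neq0_coset (V : nmodType) (f : F -> V) :
  \sum_(z | z != 0) f z = \sum_(j < l) \sum_(x in K) f (gm ^+ j * x).
Proof.
transitivity (\sum_z \sum_(j < l) f z *+ (z / gm ^+ j \in K)).
  rewrite big_mkcond; apply: eq_bigr => z _.
  by rewrite sumrMnr sum_coset_mem; case: (z != 0).
rewrite exchange_big /=; apply: eq_bigr => j _.
have gj0 : gm ^+ j != 0 by rewrite expf_neq0 // gen_neq0.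
rewrite (reindex (fun x => gm ^+ j * x)) /=; last first.
  by exists (fun x => x / gm ^+ j) => x _; rewrite mulrC ?mulKf ?divfK.
rewrite [RHS]big_mkcond; apply: eq_bigr => x _.
by rewrite mulrAC divff // mul1r; case: (x \in K).
Qed.

Lemma card_K_mul : (#|F|.-1 = l * #|K|)%N.
Proof.
have := big_neq0_coset (fun=> 1%N).
have -> : \sum_(z : F | z != 0) 1%N = #|F|.-1.
  by rewrite sum1_card -(cardC1 0); apply: eq_card.
by move->; rewrite sum_nat_const card_ord sum1_card.
Qed.

(** The map y -> 1 + g^i y is injective, and lying in g^j K is tested on a quotient. In this form
    the sums over y and over j can be exchanged. *)
Lemma cyclotomic_numberE (i j : nat) :
  cyclotomic_number gm l i j =
    (\sum_(y in K) ((1 + gm ^+ i * y) / gm ^+ j \in K)%R)%N.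
Proof.
have gn0 n : gm ^+ n != 0 by rewrite expf_neq0 // gen_neq0.
rewrite -big_mkcondr sum1_card /cyclotomic_number.
have injf : injective (fun y => 1 + gm ^+ i * y).
  by move=> x y /addrI/(mulfI (gn0 i)).
rewrite -[RHS](card_imset _ injf); apply: eq_card => z; rewrite !inE.
apply/andP/imsetP => [[/imsetP[y yK ->] /imsetP[x xK Hx]]|[y]].
  by exists y => //; rewrite unfold_in yK !exprnP Hx mulrAC divff ?mul1r // -exprnP.
rewrite unfold_in => /andP[yK Hy] ->; split; first by apply/imsetP; exists y.
by apply/imsetP; exists ((1 + gm ^+ i * y) / gm ^+ j); rewrite // -!exprnP [RHS]mulrC divfK.
Qed.

Hypothesis F_odd : odd #|F|.

Lemma gen_half : gm ^+ (#|F|.-1 %/ 2) = -1.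
Proof.
have q1 : (1 < #|F|)%N := finNzRing_gt1 F.
have even_q : (#|F|.-1 %/ 2 * 2 = #|F|.-1)%N.
  by apply/eqP; rewrite -dvdn_eq dvdn2; case: #|F| q1 F_odd.
have : (gm ^+ (#|F|.-1 %/ 2)) ^+ 2 == 1 ^+ 2.
  by rewrite -exprM even_q expr1n -(expr0 gm) gen_inj_mod modnn mod0n.
(* The square root 1 is excluded because 0 < (q-1)/2 < q-1. *)
rewrite eqf_sqr => /orP[|/eqP //].
rewrite -(expr0 gm) gen_inj_mod mod0n modn_small => [/eqP|]; move: q1 even_q; clear; lia.
Qed.

(** The terms are grouped by the coset containing 1 + g^i y, on which [f] is constant. The value
    [f 0] comes from y = -g^(-i), which lies in [K] exactly when i = h. *)
Lemma cyclotomic_sum (V : nmodType) (f : F -> V) (i : 'I_l) :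
    (forall z x, x \in K -> f (z * x) = f z) ->
  \sum_(y in K) f (1 + gm ^+ i * y) =
    f 0 *+ (i == h :> nat)
    + \sum_(j < l) f (gm ^+ j) *+ cyclotomic_number gm l i j.
Proof.
move=> fK; have gn0 n : gm ^+ n != 0 by rewrite expf_neq0 // gen_neq0.
have fE z : f z = f 0 *+ (z == 0)
    + \sum_(j < l) f (gm ^+ j) *+ (z / gm ^+ j \in K).
  transitivity (f 0 *+ (z == 0) + f z *+ (z != 0)).
    by case: eqVneq => [->|] /=; rewrite ?mulr0n ?mulr1n ?addr0 ?add0r.
  congr (_ + _); rewrite -sum_coset_mem -sumrMnr; apply: eq_bigr => j _.
  case: (boolP (_ \in K)) => // zj; rewrite -[in LHS](divfK (gn0 j) z) mulrC fK //.
rewrite (eq_bigr _ (fun y _ => fE _)) big_split /=; congr (_ + _); last first.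
  rewrite exchange_big /=; apply: eq_bigr => j _.
  by rewrite sumrMnr -cyclotomic_numberE.
rewrite sumrMnr; congr (_ *+ _).
have eq0 y : (1 + gm ^+ i * y == 0) = (y == gm ^+ (#|F|.-1 %/ 2) / gm ^+ i).
  rewrite gen_half addrC addr_eq0.
  by apply/eqP/eqP => [<-|->]; rewrite mulrC ?mulKf // divfK.
rewrite -big_mkcondr /= (eq_bigl _ _ (fun y => congr1 _ (eq0 y))).
rewrite eq_sym -coset_gen // big_mkcondl /= big_pred1_eq.
by case: ifP.
Qed.

End CyclotomicClasses.

(** * Additive characters and sums over differences *)

Lemma exists_additive_char (F : finFieldType) :
  exists psi : F -> algC,
    {morph psi : x y / x + y >-> x * y} /\
    forall c, \sum_x psi (x * c) = if c == 0 then #|F|%:R else 0.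
Proof.
have G1 : [set: F]%G != 1%g :> {set F}.
  rewrite -cardG_gt1 cardsT; exact: finNzRing_gt1.
have Gsol : solvable [set: F]%G by apply: abelian_sol; apply: FinRing.zmod_abelian.
have [i chi_lin chi1] := solvable_has_lin_char G1 Gsol.
have chiM : {morph 'chi_i : x y / x + y >-> x * y}.
  by move=> x y; rewrite -FinRing.zmodMgE lin_charM ?inE.
exists 'chi_i; split=> // c.
have [->|c0] := eqVneq c 0.
  rewrite (eq_bigr (fun=> 1)) ?sumr_const // => x _.
  by rewrite mulr0 -[X in 'chi_i X]/(1%g) lin_char1.
transitivity (\sum_x 'chi_i x).
  by rewrite [RHS](reindex_inj (mulIf c0)).
have [y chiy] : exists y, 'chi_i y != 1.
  apply/existsP; apply: contraR chi1; rewrite negb_exists => /forallP chi1.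
  by apply/eqP/cfunP=> x; rewrite cfun1E inE; apply/eqP; move: (chi1 x); rewrite negbK.
(* Translation by [y] multiplies the sum by a factor other than 1, so the sum vanishes. *)
apply/eqP; have: ('chi_i y - 1) * (\sum_x 'chi_i x) == 0.
  rewrite mulrBl mul1r mulr_sumr subr_eq0; apply/eqP.
  rewrite [RHS](reindex_inj (addrI y)) /=.
  by apply: eq_bigr => x _; rewrite chiM.
by rewrite mulf_eq0 subr_eq0 (negPf chiy).
Qed.

(** Pairs are grouped by their difference: 0 comes from the k diagonal pairs, any other d from lam
    pairs. This is the group ring identity for D times its inverse, tested on [f]. *)
Lemma difference_set_sum (G : finZmodType) (v k lam : nat) (D : {set G})
    (V : nmodType) (f : G -> V) :
    difference_set v k lam D ->
  \sum_(x in D) \sum_(y in D) f (x - y)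
    = f 0 *+ k + (\sum_(d | d != 0) f d) *+ lam.
Proof.
case=> _ cardD _ Dlam; rewrite pair_big /=.
rewrite (partition_big (fun p : G * G => p.1 - p.2) predT) //= (bigD1 0) //=.
have fiber d : \sum_(p : G * G | (p.1 \in D) && (p.2 \in D) && (p.1 - p.2 == d))
    f (p.1 - p.2)
    = f d *+ #|[set p : G * G | [&& p.1 \in D, p.2 \in D & d == p.1 - p.2]]|.
  rewrite -sumr_const; apply: eq_big => [p|p /andP[_ /eqP-> //]].
  by rewrite inE -andbA [d == _]eq_sym.
congr (_ + _); last first.
  by rewrite -sumrMnl; apply: eq_bigr => d d0; rewrite fiber Dlam.
rewrite fiber; congr (_ *+ _); rewrite -cardD.
rewrite -(card_imset (mem D) (f := fun x => (x, x))); last by move=> x y [].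
apply: eq_card => -[x y]; rewrite !inE /= eq_sym subr_eq0.
apply/and3P/imsetP => [[xD _ /eqP <-]|[z zD [-> ->]]]; first by exists x.
by split.
Qed.

(** * Gauss periods and the determinant of the shifted matrix *)

Section GaussPeriods.

Variables (F : finFieldType) (g : {unit F}) (l : nat).
Hypothesis g_gen : generator [set: {unit F}] g.
Hypothesis l_gt1 : (1 < l)%N.
Hypothesis l_dvd : (l %| #|F|.-1)%N.
Hypothesis F_odd : odd #|F|.

Local Notation K := (power_subgroup F l).
Local Notation gm := (val g : F).
Local Notation h := ((#|F|.-1 %/ 2) %% l)%N.
Local Notation k := #|K|.

Let l_gt0 : (0 < l)%N. Proof. exact: ltnW. Qed.
Let gX_neq0 e : gm ^+ e != 0. Proof. by rewrite expf_neq0 // gen_neq0. Qed.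

Variable lam : nat.
Hypothesis K_diff : difference_set #|F| k lam K.

(** Counting pairs by difference gives k^2 = k + lam l k; then k is cancelled. *)
Lemma card_K_diff : k = (lam * l).+1.
Proof.
have := difference_set_sum (fun=> 1%N) K_diff.
have -> : \sum_(x in K) \sum_(y in K) 1%N = (k * k)%N.
  rewrite (eq_bigr (fun=> k)) => [|x _]; last by rewrite sum1_card.
  by rewrite sum_nat_const.
have -> : \sum_(z : F | z != 0) 1%N = #|F|.-1.
  by rewrite sum1_card -(cardC1 0); apply: eq_card.
rewrite (card_K_mul g_gen l_gt0 l_dvd) => kk.
have k_gt0 : (0 < k)%N by apply/card_gt0P; exists 1; exact: K1.
apply/eqP; rewrite -(eqn_pmul2r k_gt0); apply/eqP; rewrite kk.
rewrite mulSn; congr (_ + _)%N; first exact: natn.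
by rewrite -mulr_natr natn -[LHS]/(l * k * lam)%N mulnC mulnA.
Qed.

(** Dividing g^i = x - y by y shows that such pairs in [K] correspond to the z = 1/y in [K] with 1 +
    g^i z in [K]. *)
Lemma cyclotomic_number_col0 (i : nat) : cyclotomic_number gm l i 0%N = lam.
Proof.
case: K_diff => _ _ _ /(_ _ (gX_neq0 i)) <-.
rewrite cyclotomic_numberE // -big_mkcondr sum1_card.
have injf : injective (fun y => (y^-1 + gm ^+ i, y^-1)).
  by move=> x y [_ /invr_inj].
rewrite -(card_imset _ injf); apply: eq_card => -[x y]; rewrite !inE /=.
have Ki z : z \in K -> (z^-1 + gm ^+ i \in K) = (1 + gm ^+ i * z \in K).
  move=> zK; rewrite -(KMr _ zK) mulrDl mulVf //; exact: K_neq0 zK.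
apply/imsetP/and3P => [[z /andP[zK]]|[xK yK /eqP gi]].
  rewrite expr0 divr1 => z1 [-> ->].
  by rewrite KV // Ki // addrAC subrr add0r eqxx.
have yVK := KV yK.
exists y^-1; last by rewrite invrK gi addrC subrK.
by apply/andP; rewrite expr0 divr1 yVK -Ki // invrK gi addrC subrK.
Qed.

Lemma cyclotomic_number_row_sum (i : 'I_l) :
  (\sum_(j < l) cyclotomic_number gm l i j + (i == h :> nat) = k)%N.
Proof.
have := cyclotomic_sum g_gen l_gt0 l_dvd F_odd i (f := fun=> 1%N) (fun _ _ _ => erefl).
rewrite sum1_card natn => ->; rewrite addnC; congr (_ + _)%N.
by apply: eq_bigr => j _; rewrite natn.
Qed.

Variable psi : F -> algC.
Hypothesis psiD : {morph psi : x y / x + y >-> x * y}.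
Hypothesis psi_sum :
  forall c, \sum_x psi (x * c) = if c == 0 then #|F|%:R else 0.

Definition gauss_period (c : F) : algC := \sum_(x in K) psi (x * c).
Local Notation eta := gauss_period.

Lemma psi0 : psi 0 = 1.
Proof.
have p0 : psi 0 != 0.
  apply/eqP => p0; have := psi_sum 0; rewrite eqxx big1 => [/eqP|x _].
    by rewrite eq_sym pnatr_eq0 -leqn0 leqNgt (ltnW (finNzRing_gt1 F)).
  by rewrite mulr0.
by apply: (mulfI p0); rewrite -psiD mulr1 addr0.
Qed.

Lemma psi_sum_neq0 c :
  \sum_(x | x != 0) psi (x * c) = #|F|%:R *+ (c == 0) - 1.
Proof.
have := psi_sum c; rewrite (bigD1 0) //= mul0r psi0 => H.
by rewrite -[LHS](addKr 1) H addrC; case: (c == 0).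
Qed.

Lemma eta_K c x : x \in K -> eta (c * x) = eta c.
Proof.
move=> xK; rewrite /eta [RHS](reindex_inj (mulIf (K_neq0 xK))) /=.
apply: eq_big => [y|y _]; first by rewrite KMr.
by congr psi; ring.
Qed.

(** For x in [K], the second period may be replaced by eta (c g^i x), so the product has terms psi
    (x c (1 + g^i y)). Summing over x first leaves eta (c (1 + g^i y)), to which [cyclotomic_sum]
    applies. *)
Lemma eta_mul (c : F) (i : 'I_l) :
  eta c * eta (c * gm ^+ i) =
    k%:R *+ (i == h :> nat)
    + \sum_(j < l) eta (c * gm ^+ j) *+ cyclotomic_number gm l i j.
Proof.
have fK z x : x \in K -> eta (c * (z * x)) = eta (c * z).
  by move=> xK; rewrite mulrA eta_K.
have := cyclotomic_sum g_gen l_gt0 l_dvd F_odd i (f := fun z => eta (c * z)) fK.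
have -> : eta (c * 0) = k%:R.
  rewrite mulr0 /eta (eq_bigr (fun=> 1)) ?sumr_const // => x _.
  by rewrite mulr0 psi0.
move=> <-.
rewrite [in RHS]/eta exchange_big /= {1}/eta mulr_suml; apply: eq_bigr => x xK.
rewrite -(eta_K (c * gm ^+ i) xK) /eta mulr_sumr; apply: eq_bigr => y _.
rewrite -psiD; congr psi; ring.
Qed.

(** The product is the sum of psi ((x - y) c). Nonzero differences contribute lam times a full sum
    over nonzero elements, which is -1. *)
Lemma eta_opp c : c != 0 -> eta c * eta (- c) = k%:R - lam%:R.
Proof.
move=> c0; have := difference_set_sum (fun d => psi (d * c)) K_diff.
rewrite mul0r psi0 psi_sum_neq0 (negPf c0) sub0r mulNrn => <-.
rewrite mulr_suml; apply: eq_bigr => x _; rewrite mulr_sumr; apply: eq_bigr => y _.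
by rewrite -psiD mulrN mulrBl.
Qed.

(** Unfolding the first period merges the sums over m and [K] into one over all nonzero z.
    Orthogonality then singles out the y in [K] with a + y b = 0. *)
Lemma sum_eta_mul a b : b != 0 ->
  \sum_(m < l) eta (gm ^+ m * a) * eta (gm ^+ m * b)
    = #|F|%:R *+ (- a / b \in K) - k%:R.
Proof.
move=> b0.
transitivity (\sum_(z | z != 0) psi (z * a) * eta (z * b)).
  rewrite (big_neq0_coset g_gen l_gt0 l_dvd); apply: eq_bigr => m _.
  rewrite mulr_suml; apply: eq_bigr => x xK.
  by rewrite -(eta_K (gm ^+ m * b) xK); congr (psi _ * eta _); ring.
transitivity (\sum_(y in K) \sum_(z | z != 0) psi (z * (a + y * b))).
  rewrite exchange_big /=; apply: eq_bigr => z _; rewrite mulr_sumr.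
  by apply: eq_bigr => y _; rewrite -psiD mulrDr mulrCA.
rewrite (eq_bigr _ (fun y _ => psi_sum_neq0 _)) sumrB sumr_const; congr (_ - _).
rewrite sumrMnr; congr (_ *+ _).
have eq0 y : (a + y * b == 0) = (y == - a / b).
  by rewrite addrC addr_eq0; apply/eqP/eqP => [<-|->]; rewrite ?mulfK ?divfK.
rewrite -big_mkcondr /= (eq_bigl _ _ (fun y => congr1 _ (eq0 y))).
by rewrite big_mkcondl /= big_pred1_eq; case: (_ \in K).
Qed.

Lemma sum_eta c : c != 0 -> \sum_(m < l) eta (c * gm ^+ m) = -1.
Proof.
move=> c0; transitivity (\sum_(z | z != 0) psi (z * c)).
  rewrite (big_neq0_coset g_gen l_gt0 l_dvd); apply: eq_bigr => m _.
  by apply: eq_bigr => x _; congr psi; ring.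
by rewrite psi_sum_neq0 (negPf c0) sub0r.
Qed.

(* If -1 were in K, all periods would be square roots of k - lam, so that the
   square of their sum -1 would be a multiple of k - lam > 1. *)
Lemma half_mod : (h = l %/ 2 /\ l = h + h)%N.
Proof.
have q1 : (1 < #|F|)%N := finNzRing_gt1 F.
have even_q : (#|F|.-1 %/ 2 * 2 = #|F|.-1)%N.
  by apply/eqP; rewrite -dvdn_eq dvdn2; case: #|F| q1 F_odd.
have l_dvd2h : (l %| h + h)%N.
  rewrite /dvdn modnDm addnn -muln2 even_q; exact: l_dvd.
have h_lt : (h < l)%N by rewrite ltn_pmod.
(* As l divides 2 h and h < l, only h = 0 and l = 2 h are possible. *)
suff h_gt0 : (0 < h)%N.
  have l2h : l = (h + h)%N.
    case/dvdnP: l_dvd2h => -[|[|t]] Ht; move: Ht h_lt h_gt0; nia.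
  by split; rewrite // [RHS](congr1 (divn^~ 2) l2h) addnn -muln2 mulnK.
rewrite lt0n; apply/negP => /eqP h0.
have N1K : -1 \in K by rewrite -(gen_half g_gen F_odd) memK_gen // /dvdn h0.
have eta_sq c : c != 0 -> eta c ^+ 2 = k%:R - lam%:R.
  by move=> c0; rewrite -(eta_opp c0) -mulrN1 eta_K.
pose s (m : 'I_l) : int := if eta (gm ^+ m) == eta 1 then 1 else -1.
have etaE (m : 'I_l) : eta (gm ^+ m) = (s m)%:~R * eta 1.
  have := eta_sq _ (gX_neq0 m); rewrite -(eta_sq 1) ?oner_neq0 // => /eqP.
  rewrite /s eqf_sqr; case: eqP => [-> _|_ /= /eqP ->]; by rewrite ?mul1r ?mulN1r.
have := sum_eta (oner_neq0 F).
rewrite (eq_bigr (fun m => (s m)%:~R * eta 1)) => [|m _]; last by rewrite mul1r etaE.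
rewrite -mulr_suml -rmorph_sum /=; set a := \sum_(m < l) s m => sum_a.
have: (a ^+ 2 * (k%:Z - lam%:Z))%:~R = (1%:~R : algC).
  rewrite rmorphM rmorphXn rmorphB /= -(eta_sq 1) ?oner_neq0 //.
  by rewrite -exprMn sum_a sqrrN expr1n.
move=> /intr_inj; rewrite card_K_diff; case: K_diff => _ _ lam_gt0 _.
have n_gt1: 1 < (lam * l).+1%:Z - lam%:Z by move: lam_gt0 l_gt1; clear; nia.
have no_factor (b n : int) : 1 < n -> 0 <= b -> b * n = 1 -> False.
  case: n b => [n|//] [b|//] n1 _ /eqP; rewrite -PoszM eqz_nat muln_eq1.
  by case/andP=> _ /eqP nE; rewrite nE in n1.
exact: no_factor n_gt1 (sqr_ge0 a).
Qed.

Definition shifted_cyclotomic_matrix : 'M[int]_l :=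
  \matrix_(i < l, j < l)
    ((cyclotomic_number gm l i j)%:Z - k%:Z *+ (i == h :> nat)).

(* The Gauss periods are the eigenvalues, with the columns of [P] as
   eigenvectors; they are paired off by [eta_opp]. *)
Lemma det_shifted_cyclotomic_matrix :
  \det shifted_cyclotomic_matrix = (k%:Z - lam%:Z) ^+ (l %/ 2).
Proof.
pose P : 'M[algC]_l := \matrix_(i < l, m < l) eta (gm ^+ m * gm ^+ i).
(* The sign turns -a / b in [sum_eta_mul] into g^i / g^j, which lies in [K] only for i = j. *)
pose Q : 'M[algC]_l := \matrix_(m < l, j < l) eta (gm ^+ m * - gm ^+ j).
pose J : 'M[algC]_l := const_mx 1.
pose D : 'rV[algC]_l := \row_(m < l) eta (gm ^+ m).
have PQ : P *m Q = #|F|%:R%:M - k%:R *: J.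
  apply/matrixP => i j; rewrite !mxE mulr1.
  rewrite (eq_bigr (fun m : 'I_l => eta (gm ^+ m * gm ^+ i) * eta (gm ^+ m * - gm ^+ j)));
    last by move=> m _; rewrite !mxE.
  rewrite sum_eta_mul ?oppr_eq0 // invrN mulrNN coset_gen // modn_small //.
have JJ : J *m J = l%:R *: J.
  apply/matrixP => i j; rewrite !mxE (eq_bigr (fun=> 1)) ?sumr_const ?card_ord ?mulr1 //.
  by move=> m _; rewrite !mxE mulr1.
have qE : #|F| = (l * k).+1.
  by rewrite -(card_K_mul g_gen l_gt0 l_dvd) prednK // ltnW // finNzRing_gt1.
(* The coefficient of [J] is q k - k - k^2 l, which vanishes since q = l k + 1. *)
have PQJ : P *m (Q *m (1%:M + k%:R *: J)) = #|F|%:R%:M.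
  rewrite mulmxA PQ mulmxDr mulmx1 -scalemxAr mulmxBl -scalemxAl JJ mul_scalar_mx.
  rewrite scalerBr !scalerA -scalerBl -addrA [- _ + _]addrC -scalerBl.
  rewrite [X in X *: J](_ : _ = 0) ?scale0r ?addr0 // qE -natr1 natrM; ring.
have detP : \det P != 0.
  apply/eqP => P0; have /eqP := congr1 determinant PQJ.
  rewrite det_mulmx P0 mul0r det_scalar eq_sym expf_eq0 pnatr_eq0 qE andbF //.
(* The shift of row h absorbs the term k [i = h] of [eta_mul], since each column of [P] sums to
   -1. *)
have MP : map_mx intr shifted_cyclotomic_matrix *m P = P *m diag_mx D.
  apply/matrixP => i m; rewrite mul_mx_diag !mxE mulrC eta_mul.
  rewrite (eq_bigr (fun j : 'I_l =>
      eta (gm ^+ m * gm ^+ j) *+ cyclotomic_number gm l i j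
      - eta (gm ^+ m * gm ^+ j) * (k%:R *+ (i == h :> nat)))); last first.
    move=> j _; rewrite !mxE rmorphB rmorphMn /= mulrC mulrBr mulr_natr //.
  by rewrite sumrB -mulr_suml sum_eta // mulN1r opprK addrC.
have detD : \prod_(m < l) eta (gm ^+ m) = (k%:R - lam%:R) ^+ (l %/ 2).
  have [hE lE] := half_mod.
  rewrite -(big_mkord xpredT (fun m => eta (gm ^+ m))).
  rewrite (big_cat_nat (n := h)) //=; last by rewrite ltnW // ltn_pmod.
  rewrite -{2}[h]add0n big_addn [in X in (X - h)%N]lE addnK -big_split /=.
  rewrite big_mkord (eq_bigr (fun=> k%:R - lam%:R)).
    by rewrite prodr_const card_ord -hE.
  move=> m _; rewrite -(eta_opp (gX_neq0 m)); congr (_ * _).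
  (* Thus -1 lies in g^h K, so the periods at g^(m+h) and at -g^m agree. *)
  have N1E : -1 = gm ^+ h * gm ^+ (#|F|.-1 %/ 2 %/ l * l).
    by rewrite -exprD addnC -divn_eq (gen_half g_gen F_odd).
  by rewrite -mulrN1 N1E mulrA eta_K ?exprD // memK_gen // dvdn_mull.
apply: (@intr_inj algC); rewrite -det_map_mx.
apply: (mulIf detP); rewrite -det_mulmx MP det_mulmx det_diag mulrC; congr (_ * _).
rewrite (eq_bigr (fun m : 'I_l => eta (gm ^+ m))) => [|m _]; last by rewrite mxE.
by rewrite detD rmorphXn rmorphB.
Qed.

End GaussPeriods.

(** * Cofactor relations and the two determinants *)

Lemma cofactor_mulmx (R : comPzRingType) (n : nat) (A : 'M[R]_n) (c : 'I_n)
    (u v : 'I_n -> R) :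
    (forall i, \sum_j A i j * u j = v i) ->
  \sum_i cofactor A i c * v i = \det A * u c.
Proof.
(* Entry c of adj(A) A u = det(A) u: any known product A u gives a linear relation between det A and
   the cofactors of column c. *)
move=> Auv; have /matrixP/(_ c ord0) :=
  congr1 (fun M => M *m \col_j u j) (mul_adj_mx A).
rewrite -mulmxA mul_scalar_mx !mxE => <-; apply: eq_bigr => i _.
by rewrite !mxE -Auv; congr (_ * _); apply: eq_bigr => j _; rewrite mxE.
Qed.

Theorem corollary5p21 (p r q : nat) (p_prime : prime p) (p_odd : odd p)
    (q_def : q = (p ^ r)%N)
    (F : finFieldType) (card_F : #|F| = q)
    (g : {unit F}) (g_gen : generator [set: {unit F}] g)
    (l : nat) (l_ge2 : (2 <= l)%N) (l_dvd : (l %| q.-1)%N)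
    (k : nat) (k_def : k = (q.-1 %/ l)%N)
    (lam : nat) (K_diff : difference_set q k lam (power_subgroup F l)) :
  \det (cyclotomic_matrix (val g) l)
    = - lam%:Z * (k%:Z - lam%:Z) ^+ (l %/ 2 - 1)
  /\ \det (cyclotomic_submatrix (val g) (ltnW l_ge2))
    = (-1) ^+ (l %/ 2 - 1) * (k%:Z - lam%:Z) ^+ (l %/ 2).
Proof.
move: K_diff k_def l_dvd; rewrite -card_F => {}K_diff _ {}l_dvd.
have F_odd : odd #|F| by rewrite card_F q_def oddX p_odd orbT.
have cardK : #|power_subgroup F l| = k by case: K_diff.
rewrite -cardK in K_diff *.
have [psi [psiD psi_sum]] := exists_additive_char F.
have [hE _] := half_mod g_gen l_ge2 l_dvd F_odd K_diff psiD psi_sum.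
have detA' := det_shifted_cyclotomic_matrix
  g_gen l_ge2 l_dvd F_odd K_diff psiD psi_sum.
have kE := card_K_diff g_gen l_ge2 l_dvd K_diff.
have l_gt0 := ltnW l_ge2.
have qE : #|F| = (l * #|power_subgroup F l|).+1.
  rewrite -(card_K_mul g_gen l_gt0 l_dvd) prednK // ltnW //.
  exact: finNzRing_gt1.
have row_sum (i : 'I_l) :
    \sum_(j < l) (cyclotomic_number (val g) l i j)%:Z
      = #|power_subgroup F l|%:Z - (i == (#|F|.-1 %/ 2 %% l)%N :> nat)%:Z.
  rewrite -(cyclotomic_number_row_sum g_gen l_ge2 l_dvd F_odd i) PoszD addrK.
  by rewrite -(big_morph Posz PoszD (erefl _)).
have col0 (i : 'I_l) : (cyclotomic_number (val g) l i 0%N) = lam.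
  exact: cyclotomic_number_col0 K_diff i.
set A := cyclotomic_matrix (val g) l.
set A' := shifted_cyclotomic_matrix g l in detA'.
set k' := #|power_subgroup F l| in kE qE row_sum detA' *.
pose c := Ordinal l_gt0; pose r0 := Ordinal (ltn_pmod (#|F|.-1 %/ 2) l_gt0).
pose b := cofactor A r0 c.
(* [A] and [A'] differ only in the row that this cofactor deletes. *)
have b' : cofactor A' r0 c = b.
  rewrite /b /cofactor; congr (_ * \det _); apply/matrixP => i j.
  rewrite !mxE eq_sym (negPf (neq_bump _ _)) subr0 //.
have detB : b = (-1) ^+ (l %/ 2) * \det (cyclotomic_submatrix (val g) (ltnW l_ge2)).
  rewrite /b /cofactor /= addn0 hE; congr (_ * \det (row' _ (col' _ _))).
(* The sums [S] and [S'] are auxiliary unknowns. Applying each matrix to the all-ones vector and to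
   the basis vector at 0 gives two relations per matrix, from which they are eliminated. *)
pose S := \sum_i cofactor A i c; pose S' := \sum_i cofactor A' i c.
have sum_delta (M : 'M[int]_l) (x y : int) :
    \sum_i cofactor M i c * (x - y *+ (i == r0)) =
    (\sum_i cofactor M i c) * x - cofactor M r0 c * y.
  rewrite mulr_suml [in RHS](bigD1 r0) //= [in LHS](bigD1 r0) //= eqxx mulr1n.
  rewrite mulrBr addrAC; congr (_ + _ - _); apply: eq_bigr => i /negPf->.
  by rewrite mulr0n subr0.
have eqA1 : S * k'%:Z - b = \det A.
  have := @cofactor_mulmx _ _ A c (fun=> 1) (fun i => k'%:Z - 1 *+ (i == r0)).
  rewrite sum_delta !mulr1; apply=> i.
  rewrite -(inj_eq val_inj) -[1 *+ _]/(_%:R) natz -row_sum.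
  by apply: eq_bigr => j _; rewrite mulr1 mxE.
have eqA2 : S * lam%:Z = \det A.
  have := @cofactor_mulmx _ _ A c (fun j => (j == c)%:R) (fun i => lam%:Z).
  rewrite -mulr_suml /= mulr1; apply=> i.
  rewrite (bigD1 c) //= big1 => [|j /negPf->]; last by rewrite mulr0.
  by rewrite mulr1 addr0 mxE col0.
(* Row h of [A'] sums to k - 1 - l k = k - q. *)
have eqA'1 : S' * k'%:Z - b * #|F|%:Z = \det A'.
  have := @cofactor_mulmx _ _ A' c (fun=> 1) (fun i => k'%:Z - #|F|%:Z *+ (i == r0)).
  rewrite sum_delta b' !mulr1; apply=> i.
  rewrite (eq_bigr (fun j : 'I_l => (cyclotomic_number (val g) l i j)%:Z
      - k'%:Z *+ (i == r0))) => [|j _]; last by rewrite mulr1 mxE.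
  rewrite sumrB row_sum sumr_const card_ord -(inj_eq val_inj) /=.
  case: eqP => _; last by rewrite !mulr0n mul0rn !subr0.
  rewrite !mulr1n qE -mulr_natr natz; lia.
have eqA'2 : S' * lam%:Z - b * k'%:Z = \det A'.
  have := @cofactor_mulmx _ _ A' c (fun j => (j == c)%:R)
    (fun i => lam%:Z - k'%:Z *+ (i == r0)).
  rewrite sum_delta b' /= mulr1; apply=> i.
  rewrite (bigD1 c) //= big1 => [|j /negPf->]; last by rewrite mulr0.
  by rewrite mulr1 addr0 mxE col0.
set n := k'%:Z - lam%:Z in detA' *.
have n_neq0 : n != 0 by rewrite subr_eq0 eqz_nat kE; have := l_ge2; clear; nia.
have n_eq : n = k'%:Z ^+ 2 - lam%:Z * #|F|%:Z.
  by rewrite /n qE kE -[(lam * l).+1]addn1 -[(_ * (_ + 1)).+1]addn1 !(PoszD, PoszM); ring.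
(* Eliminating [S'] gives b (k^2 - lam q) = -(k - lam) det A', and both factors equal [n]. *)
have bE : b = - \det A'.
  apply: (mulfI n_neq0).
  have -> : n * - \det A' = lam%:Z * \det A' - k'%:Z * \det A' by rewrite /n; ring.
  by rewrite -{1}eqA'1 -eqA'2 n_eq; ring.
have m_gt0 : (0 < l %/ 2)%N by rewrite divn_gt0.
have detA'_split : \det A' = n * n ^+ (l %/ 2 - 1) by rewrite detA' -exprS subn1 prednK.
split.
  (* Eliminating [S] between the two relations for [A] gives n det A = lam b. *)
  apply: (mulfI n_neq0).
  have -> : n * (- lam%:Z * n ^+ (l %/ 2 - 1)) = lam%:Z * b.
    by rewrite bE detA'_split; ring.
  have -> : n * \det A = k'%:Z * \det A - lam%:Z * \det A by rewrite /n; ring.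
  by rewrite -{1}eqA2 -eqA1; ring.
(* The cofactor sign (-1)^(l/2) and the minus sign in [bE] combine to (-1)^(l/2 - 1). *)
rewrite -detA' -[LHS](signrMK (l %/ 2)%N) -detB bE mulrN -mulNr.
by rewrite -[(l %/ 2)%N]prednK // exprS mulN1r opprK subn1.
Qed.
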